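(* Given a triple $(a,b,c)$ of positive integers and a pair $(P,Q)$ of matrices such that $P\in M_{a\times b}$, $Q\in M_{b\times c}$, define the matrices $P_i$, $Q_i$, $T_{i,j}$ by $$P_i=\Phi^i(P),\quad Q_i=\Phi^i(Q),\quad i\ge 0,\qquad T_{i,j}=P_iQ_j-P_jQ_i,\quad 0\le i<j,$$ and set $n=\max\{a+b-1,b+c-1\}$. Then $P_i=Q_i=0$ for $i\ge n$, and the set $\mathcal T=\{T_{i,j}:0\le i<j\le n-1\}$ is linearly independent if and only if exactly one of the following three conditions holds: (1) $P_{a,1}\ne 0$, $Q_{b,1}\neq 0$ and $(a,b,c)\in\{(n,1,n),(n-1,2,n-1),(n,1,n-1),(n-1,1,n)\}$; (2) $P_{a,1}=0$, $P_{a-1,1}\neq 0$, $Q_{b,1}\neq 0$ and $(a,b,c)=(n,1,n)$; (3) $P_{a,1}\neq 0$, $Q_{b,1}=0$, $Q_{b,2}\neq 0$ and $(a,b,c)=(n,1,n)$.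
   Context: $F$ is an algebraically closed field of characteristic $0$ and $M_{p\times q}$ is the space of $p\times q$ matrices over $F$; $X_{i,j}$ denotes the $(i,j)$ entry of a matrix $X$. $J^p(0)$ denotes the upper triangular nilpotent Jordan block of size $p$ (ones on the first superdiagonal, zeros elsewhere). For integers $p,q\ge1$, $\Phi=\Phi_{p,q}:M_{p\times q}\to M_{p\times q}$ is the nilpotent linear operator $\Phi(X)=J^p(0)X-XJ^q(0)$; thus $\Phi^i(P)$ uses $\Phi_{a,b}$ and $\Phi^i(Q)$ uses $\Phi_{b,c}$.
   Formalization: The equivalence is stated only for n ≥ 2, i.e. (a,b,c) ≠ (1,1,1): for a=b=c=1 the set T is empty, hence independent, yet with P=0 or Q=0 none of (1)–(3) holds (and P_{0,1}, Q_{1,2} do not exist). *)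

(* Defs.v *)
From HB Require Import structures.
From mathcomp Require Import all_boot all_order all_algebra.

Set Implicit Arguments.
Unset Strict Implicit.
Unset Printing Implicit Defensive.

Import GRing.Theory.
Local Open Scope ring_scope.

Definition nilJordan (F : fieldType) (p : nat) : 'M[F]_p :=
  \matrix_(i, j) (j == i.+1 :> nat)%:R.

Definition Phi (F : fieldType) (p q : nat) (X : 'M[F]_(p, q)) : 'M[F]_(p, q) :=
  nilJordan F p *m X - X *m nilJordan F q.

Definition Phi_iter (F : fieldType) (p q : nat) (i : nat)
    (X : 'M[F]_(p, q)) : 'M[F]_(p, q) :=
  iter i (@Phi F p q) X.

Definition Tmx (F : fieldType) (a b c : nat) (P : 'M[F]_(a, b))
    (Q : 'M[F]_(b, c)) (i j : nat) : 'M[F]_(a, c) :=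
  Phi_iter i P *m Phi_iter j Q - Phi_iter j P *m Phi_iter i Q.

(* i and j are 1-based; the value is 0 when (i, j) is outside the matrix. *)
Definition mxentry (F : fieldType) (p q : nat) (X : 'M[F]_(p, q))
    (i j : nat) : F :=
  if ([pick k : 'I_p | k.+1 == i], [pick l : 'I_q | l.+1 == j])
    is (Some k, Some l) then X k l else 0.

Definition exactly_one3 (A B C : Prop) : Prop :=
  [\/ [/\ A, ~ B & ~ C], [/\ ~ A, B & ~ C] | [/\ ~ A, ~ B & C]].

(* Main.v *)
Require Import Defs.
From HB Require Import structures.
From mathcomp Require Import all_boot all_order all_algebra.
From mathcomp Require Import zify ring.

Set Implicit Arguments.
Unset Strict Implicit.
Unset Printing Implicit Defensive.

Import GRing.Theory.
Local Open Scope ring_scope.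

(* Grade the positions [(r, k)] by [k - r]: then [Phi] has degree one. A nonzero
   [T_{n-2,n-1}] forces [2n - 3 + (smallest degree in P) + (smallest degree in Q)
   <= c - 1], which leaves only the listed shapes and entry conditions.
   Conversely, in each of these cases a suitable matrix position [pos i j] detects
   the leading term of [T_{i,j}], and the matrix of these coordinates is
   triangular with nonzero diagonal when [(i, j)] is ordered by [i + 2j].
   Characteristic 0 enters only for [b = 2], where the diagonal coefficient is
   [+- j] or, when [j = i + 1], [+- 2j]. *)

(** * Matrix entries with 1-based indices and default value 0 *)

Section MatrixEntries.
Variable F : fieldType.

Lemma mxentry_ord p q (X : 'M[F]_(p, q)) (i : 'I_p) (j : 'I_q) :
  mxentry X i.+1 j.+1 = X i j.
Proof.
rewrite /mxentry; case: pickP => [k /eqP[/val_inj->] | /(_ i)]; last by rewrite eqxx.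
by case: pickP => [l /eqP[/val_inj->] | /(_ j)] //; rewrite eqxx.
Qed.

Lemma mxentry_out p q (X : 'M[F]_(p, q)) r k :
  ~~ [&& 0 < r, r <= p, 0 < k & k <= q]%N -> mxentry X r k = 0.
Proof.
move=> out; rewrite /mxentry; case: pickP => // i /eqP def_r.
case: pickP => // j /eqP def_k; case/negP: out.
by rewrite -def_r -def_k /= !ltn_ord.
Qed.

Lemma mxentryP p q (X Y : 'M[F]_(p, q)) :
  (forall r k, mxentry X r k = mxentry Y r k) -> X = Y.
Proof. by move=> eqXY; apply/matrixP=> i j; rewrite -!mxentry_ord. Qed.

Lemma mxentry_is_scalar p q r k : scalar (fun X : 'M[F]_(p, q) => mxentry X r k).
Proof.
move=> x X Y; rewrite /mxentry; case: pickP => [i _ | _]; last by rewrite mulr0 addr0.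
by case: pickP => [j _ | _]; rewrite ?mxE // mulr0 addr0.
Qed.

(** Packages [mxentry] at a position as a linear form, to serve as a coordinate in the triangularity
    argument. *)
Definition entry_fun p q (u : nat * nat) (X : 'M[F]_(p, q)) : F := mxentry X u.1 u.2.

HB.instance Definition _ p q u :=
  GRing.isLinear.Build F 'M[F]_(p, q) F _ (@entry_fun p q u)
    (mxentry_is_scalar u.1 u.2).

Lemma mxentry0 p q r k : mxentry (0 : 'M[F]_(p, q)) r k = 0.
Proof. exact: (raddf0 (@entry_fun p q (r, k))). Qed.

Lemma mxentryB p q (X Y : 'M[F]_(p, q)) r k :
  mxentry (X - Y) r k = mxentry X r k - mxentry Y r k.
Proof. exact: (raddfB (@entry_fun p q (r, k))). Qed.

Lemma mxentryM p q s (X : 'M[F]_(p, q)) (Y : 'M[F]_(q, s)) r k :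
  mxentry (X *m Y) r k = \sum_(l < q) mxentry X r l.+1 * mxentry Y l.+1 k.
Proof.
have [/and4P[] | out] := boolP [&& 0 < r, r <= p, 0 < k & k <= s]%N.
  case: r k => [//|r] [//|k] _ ltr _ ltk.
  rewrite -[r]/(val (Ordinal ltr)) -[k]/(val (Ordinal ltk)) mxentry_ord mxE.
  by apply: eq_bigr => l _; rewrite !mxentry_ord.
rewrite mxentry_out // big1 // => l _.
case out_r: ((0 < r) && (r <= p))%N.
  by rewrite [X in _ * X]mxentry_out ?mulr0 //; lia.
by rewrite mxentry_out ?mul0r //; lia.
Qed.

(** The default value 0 absorbs the borders [r = p] and [k = 1]. The hypotheses exclude [r = 0] and
    [k = q + 1], where the right side may read a true entry although the left side is 0. *)
Lemma mxentry_Phi p q (X : 'M[F]_(p, q)) r k : (0 < r)%N -> (k <= q)%N ->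
  mxentry (Phi X) r k = mxentry X r.+1 k - mxentry X r k.-1.
Proof.
move=> r_gt0 le_kq.
have [/andP[] | out] := boolP ((r <= p) && (0 < k))%N; last first.
  by rewrite !mxentry_out ?subr0 //; lia.
case: r k r_gt0 le_kq => [//|r] [//|k] _ ltk ltr _ /=.
set i := Ordinal ltr; set j := Ordinal ltk.
have [eq_i eq_j] : i = r :> nat /\ j = k :> nat by [].
rewrite [LHS](mxentry_ord (Phi X) i j) !mxE; congr (_ - _).
  have [lt_ip | le_pi] := ltnP r.+1 p.
    rewrite [RHS](mxentry_ord X (Ordinal lt_ip) j) (bigD1 (Ordinal lt_ip)) //=.
    rewrite mxE eqxx mul1r big1 ?addr0 // => l; rewrite -val_eqE /= => /negPf neq.
    by rewrite mxE neq mul0r.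
  rewrite mxentry_out ?big1 // => [l _|]; last by lia.
  by rewrite mxE [_ == _]negbTE ?mul0r //; have := ltn_ord l; rewrite eq_i; lia.
have [j0 | j_gt0] := posnP k.
  rewrite mxentry_out ?big1 // => [l _|]; last by lia.
  by rewrite mxE eq_j j0 mulr0.
have lt_j1 : (k.-1 < q)%N by lia.
rewrite -[k in RHS](prednK j_gt0) [RHS](mxentry_ord X i (Ordinal lt_j1)).
rewrite (bigD1 (Ordinal lt_j1)) //= mxE /= prednK // eqxx mulr1.
rewrite big1 ?addr0 // => l; rewrite -val_eqE /= => neq.
by rewrite mxE [_ == _]negbTE ?mulr0 //; move: j_gt0 neq; rewrite /=; lia.
Qed.

End MatrixEntries.

(** * The degree filtration and vanishing results *)

Section Filtration.
Variable F : fieldType.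

(* [Phi] raises the degree [k - r] of the position [(r, k)] by one; the smallest
   degree of a [p] by [q] matrix is [1 - p], which corresponds to [d = 1]. *)
Definition supported_above p q d (X : 'M[F]_(p, q)) : Prop :=
  forall r k, (k + p < r + d)%N -> mxentry X r k = 0.

Lemma supported_above1 p q (X : 'M[F]_(p, q)) : supported_above 1 X.
Proof. by move=> r k ltkr; apply: mxentry_out; lia. Qed.

Lemma supported_above_Phi_iter p q d i (X : 'M[F]_(p, q)) :
  supported_above d X -> supported_above (i + d) (Phi_iter i X).
Proof.
elim: i => [//|i IHi] /IHi{IHi} suppX r k ltkr; rewrite [Phi_iter _ _]/=.
have [/andP[r_gt0 le_kq] | out] := boolP ((0 < r) && (k <= q))%N; last first.
  by apply: mxentry_out; lia.
rewrite mxentry_Phi // suppX; last by lia.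
(* For [k = 0] the predecessor is again 0, so the degree does not drop; column 0 is outside the
   matrix. *)
case: k ltkr le_kq => [|k] ltkr le_kq /=; last by rewrite suppX ?subr0 //; lia.
by rewrite mxentry_out ?subr0 //; lia.
Qed.

Lemma Phi_iter_nilpotent p q i (X : 'M[F]_(p, q)) :
  (p + q <= i.+1)%N -> Phi_iter i X = 0.
Proof.
move=> le_i; apply: mxentryP => r k; rewrite mxentry0.
have [/andP[r_gt0 le_kq] | out] := boolP ((0 < r) && (k <= q))%N; last first.
  by apply: mxentry_out; lia.
by apply: (supported_above_Phi_iter (@supported_above1 _ _ X)); lia.
Qed.

(** Degrees add in a product, since [k - r = (l - r) + (k - l)], and no position of a [p] by [s]
    matrix has degree above [s - 1]. *)
Lemma supported_above_mul p q s d e (X : 'M[F]_(p, q)) (Y : 'M[F]_(q, s)) :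
  supported_above d X -> supported_above e Y ->
  (p + q + s <= d + e)%N -> X *m Y = 0.
Proof.
move=> suppX suppY lt_de; apply: mxentryP => r k; rewrite mxentry0 mxentryM big1 // => l _.
have [/andP[r_gt0 le_ks] | out] := boolP ((0 < r) && (k <= s))%N; last first.
  have [r0|r_gt0] := posnP r; first by rewrite mxentry_out ?mul0r //; lia.
  by rewrite [X in _ * X]mxentry_out ?mulr0 //; lia.
have [lt_lr | le_rl] := ltnP (l.+1 + p) (r + d); first by rewrite suppX ?mul0r.
by rewrite [X in _ * X]suppY ?mulr0 //; lia.
Qed.

Lemma Tmx_neq0_bound a b c (P : 'M[F]_(a, b)) (Q : 'M[F]_(b, c)) d e i j :
  supported_above d P -> supported_above e Q ->
  Tmx P Q i j != 0 -> (i + j + d + e < a + b + c)%N.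
Proof.
move=> suppP suppQ; apply: contraR; rewrite -leqNgt => lt_abc; apply/eqP.
have suppPi l := supported_above_Phi_iter (i := l) suppP.
have suppQi l := supported_above_Phi_iter (i := l) suppQ.
by rewrite /Tmx !(supported_above_mul (suppPi _) (suppQi _)) ?subr0 //; lia.
Qed.

(** The corner [(p, 1)] is the only position of smallest degree. *)
Lemma supported_above2 p q (X : 'M[F]_(p, q)) :
  mxentry X p 1 = 0 -> supported_above 2 X.
Proof.
move=> X0 r k ltkr.
have [/andP[/eqP -> /eqP ->] // | ?] := boolP ((r == p) && (k == 1))%N.
by apply: mxentry_out; lia.
Qed.

Lemma supported_above3_col p (X : 'M[F]_(p, 1)) :
  mxentry X p 1 = 0 -> mxentry X (p - 1) 1 = 0 -> supported_above 3 X.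
Proof.
move=> X0 X1 r k ltkr; have [/eqP -> | neq_rp] := boolP (r == p).
  by have [/eqP -> // | ?] := boolP (k == 1)%N; apply: mxentry_out; lia.
have [/andP[/eqP -> /eqP ->] // | ?] := boolP ((r == p - 1) && (k == 1))%N.
by apply: mxentry_out; lia.
Qed.

Lemma supported_above3_row q (X : 'M[F]_(1, q)) :
  mxentry X 1 1 = 0 -> mxentry X 1 2 = 0 -> supported_above 3 X.
Proof.
move=> X0 X1 r k ltkr.
have [/andP[/eqP -> k12] | ?] := boolP ((r == 1) && ((k == 1) || (k == 2)))%N.
  by case/orP: k12 => /eqP ->.
by apply: mxentry_out; lia.
Qed.

End Filtration.

(** * Linear independence from triangular coordinates *)

Section Triangularity.
Variable F : fieldType.

(** Induction on the rank: applying [L x] to a vanishing combination leaves only the term of [x] and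
    terms of smaller rank, whose coefficients are already known to vanish. *)
Lemma free_triangular (V : vectType F) (I : eqType) (s : seq I) (t : I -> V)
    (L : I -> {scalar V}) (rk : I -> nat) :
  uniq s -> {in s, forall x, L x (t x) != 0} ->
  {in s &, forall x y, L x (t y) != 0 -> y = x \/ (rk y < rk x)%N} ->
  free [seq t x | x <- s].
Proof.
move=> uniq_s diag trig; apply/(freeP (X := in_tuple [seq t x | x <- s])) => k sum0.
case: s uniq_s diag trig k sum0 => [|x0 s0] uniq_s diag trig k sum0; first by case.
set s := x0 :: s0 in uniq_s diag trig k sum0 *.
have lt_s (i : 'I_(size (map t s))) : (i < size s)%N by rewrite -(size_map t).
have mem_s (i : 'I_(size (map t s))) : nth x0 s i \in s by rewrite mem_nth.
have nthE (i : 'I_(size (map t s))) : (in_tuple (map t s))`_i = t (nth x0 s i).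
  exact: nth_map.
suffices k0 m (i : 'I_(size (map t s))) : (rk (nth x0 s i) < m)%N -> k i = 0.
  by move=> i; apply: k0 (ltnSn _).
elim: m i => [//|m IHm] i ltm.
have := congr1 (L (nth x0 s i)) sum0.
rewrite raddf0 raddf_sum (bigD1 i) //= big1 => [|j neq_ji]; last first.
  rewrite nthE linearZ /=.
  have [-> | neq0] := eqVneq (L (nth x0 s i) (t (nth x0 s j))) 0; first by rewrite mulr0.
  case: (trig _ _ (mem_s i) (mem_s j) neq0) => [/eqP | lt_rk].
    by rewrite nth_uniq // => /eqP/val_inj eq_ji; rewrite eq_ji eqxx in neq_ji.
  by rewrite IHm ?mul0r //; apply: leq_trans lt_rk ltm.
rewrite nthE addr0 linearZ /= => /eqP; rewrite mulf_eq0.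
by rewrite (negPf (diag _ (mem_s i))) orbF => /eqP.
Qed.

(* The rank [i + 2j] increases when [(i, j)] moves up in the product order and
   also, which matters for [b = 2], along [(i + 1, j - 1) -> (i, j)]. *)
Lemma free_Tmx_triangular a b c (P : 'M[F]_(a, b)) (Q : 'M[F]_(b, c)) n
    (pos : nat -> nat -> nat * nat) :
  (forall i j, (i < j < n)%N -> mxentry (Tmx P Q i j) (pos i j).1 (pos i j).2 != 0) ->
  (forall i j i' j', (i < j < n)%N -> (i' < j' < n)%N ->
     mxentry (Tmx P Q i' j') (pos i j).1 (pos i j).2 != 0 ->
     (i' = i /\ j' = j) \/ (i' + j' * 2 < i + j * 2)%N) ->
  free [seq Tmx P Q i j | j <- iota 0 n, i <- iota 0 j].
Proof.
move=> diag trig.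
pose s := [seq (i, j) | j <- iota 0 n, i <- iota 0 j].
have mem_s x : x \in s -> (x.1 < x.2 < n)%N.
  by case/allpairsPdep=> [j [i [+ + ->]]]; rewrite !mem_iota /=; lia.
have -> : [seq Tmx P Q i j | j <- iota 0 n, i <- iota 0 j] =
          [seq Tmx P Q x.1 x.2 | x <- s].
  by rewrite map_allpairs.
apply: (@free_triangular _ _ _ _ (fun x => @entry_fun F a c (pos x.1 x.2))
          (fun x => x.1 + x.2 * 2)%N).
- apply: allpairs_uniq_dep => [|j _|[j i] [j' i'] _ _ /= [-> ->] //]; exact: iota_uniq.
- by move=> x /mem_s; apply: diag.
- move=> [i j] [i' j'] /mem_s /= ij /mem_s /= ij' /(trig _ _ _ _ ij ij').
  by case=> [[-> ->] | ]; [left | right].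
Qed.

End Triangularity.

(** * Closed forms for [b = 1] and [b = 2], and sufficiency *)

Section ClosedForms.
Variable F : fieldType.

Lemma mxentry_Phi_iter_col1 p q i r (X : 'M[F]_(p, q)) : (0 < q)%N -> (0 < r)%N ->
  mxentry (Phi_iter i X) r 1 = mxentry X (r + i) 1.
Proof.
move=> q_gt0; elim: i r => [|i IHi] r r_gt0; first by rewrite addn0.
rewrite [Phi_iter _ _]/= mxentry_Phi // IHi // addSnnS.
by rewrite [X in _ - X]mxentry_out ?subr0 //=; lia.
Qed.

(** [Phi] is a difference of two commuting shifts; in the binomial expansion of its powers, only the
    terms with at most one column shift reach column 2. *)
Lemma mxentry_Phi_iter_col2 p q i r (X : 'M[F]_(p, q)) : (1 < q)%N -> (0 < r)%N ->
  mxentry (Phi_iter i X) r 2 = mxentry X (r + i) 2 - i%:R * mxentry X (r + i).-1 1.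
Proof.
move=> q_gt1; elim: i r => [|i IHi] r r_gt0; first by rewrite addn0 mul0r subr0.
rewrite [Phi_iter _ _]/= mxentry_Phi // IHi // mxentry_Phi_iter_col1 //; last by lia.
rewrite addSn addnS /= -natr1; ring.
Qed.

Lemma mxentry_Phi_iter_last p q j k (X : 'M[F]_(p, q)) : (0 < p)%N -> (k <= q)%N ->
  mxentry (Phi_iter j X) p k = (-1) ^+ j * mxentry X p (k - j).
Proof.
move=> p_gt0; elim: j k => [|j IHj] k le_kq; first by rewrite mul1r subn0.
rewrite [Phi_iter _ _]/= mxentry_Phi // [X in X - _]mxentry_out; last by lia.
rewrite IHj; last by lia.
by rewrite exprS mulN1r mulNr sub0r -subn1 -subnDA add1n.
Qed.

Lemma mxentry_Phi_iter_row1 q j k (X : 'M[F]_(2, q)) : (k <= q)%N ->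
  mxentry (Phi_iter j X) 1 k =
    (-1) ^+ j * (mxentry X 1 (k - j) - j%:R * mxentry X 2 (k.+1 - j)).
Proof.
elim: j k => [|j IHj] k le_kq; first by rewrite mul0r subr0 mul1r subn0.
rewrite [Phi_iter _ _]/= mxentry_Phi // mxentry_Phi_iter_last // IHj; last by lia.
rewrite exprS -natr1 subSS.
have -> : (k.-1 - j = k - j.+1)%N by lia.
case: k le_kq => [|k] le_kq; last by ring.
(* At [k = 0] the formula reads column [1 - j], which can be inside the matrix only for [j = 0],
   where the factor [j] is zero. *)
rewrite !sub0n ![mxentry _ _ 0]mxentry_out //; case: j {IHj} => [|j]; first by ring.
by rewrite subSS sub0n [mxentry _ _ 0]mxentry_out //; ring.
Qed.

Lemma mxentry_Tmx_outer a c (P : 'M[F]_(a, 1)) (Q : 'M[F]_(1, c)) i j r k :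
  (0 < r)%N -> (k <= c)%N ->
  mxentry (Tmx P Q i j) r k =
    (-1) ^+ j * mxentry P (r + i) 1 * mxentry Q 1 (k - j)
    - (-1) ^+ i * mxentry P (r + j) 1 * mxentry Q 1 (k - i).
Proof.
move=> r_gt0 le_kc; rewrite mxentryB !mxentryM !big_ord1 /=.
by rewrite !mxentry_Phi_iter_col1 // !mxentry_Phi_iter_last //; ring.
Qed.

(* [A] is the last index of a nonzero entry of the column [P] and [B] the first
   one for the row [Q]; the leading positions of [P_i Q_j] and [P_j Q_i] are
   [(A - i, B + j)] and [(A - j, B + i)], at least one of which has to exist. *)
Lemma free_Tmx_outer a c (P : 'M[F]_(a, 1)) (Q : 'M[F]_(1, c)) n A B :
  mxentry P A 1 != 0 -> mxentry Q 1 B != 0 ->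
  (forall r, (A < r)%N -> mxentry P r 1 = 0) ->
  (forall k, (k < B)%N -> mxentry Q 1 k = 0) ->
  (n <= A.+1 /\ B + n <= c.+1 \/ n <= A /\ B + n <= c.+2)%N ->
  free [seq Tmx P Q i j | j <- iota 0 n, i <- iota 0 j].
Proof.
move=> PA QB P0 Q0.
have B_gt0 : (0 < B)%N by apply: contraNT QB => B0; rewrite mxentry_out //; lia.
move=> [] [le_nA le_nB].
  (* As [i <= n - 2] and [j <= n - 1], the first alternative keeps [(A - i, B + j)] inside the
     matrix; the second one does so for [(A - j, B + i)]. *)
  apply: (free_Tmx_triangular (pos := fun i j => (A - i, B + j)%N)) => /= [i j | i j i' j'] ij.
    rewrite mxentry_Tmx_outer ?subnK ?addnK; try lia.
    by rewrite (P0 (A - i + j)%N) ?mulr0 ?mul0r ?subr0 ?mulf_neq0 ?signr_eq0 //; lia.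
  move=> ij'; rewrite mxentry_Tmx_outer; try lia.
  have [le_i' | lt_i'] := leqP i' i; last first.
    by rewrite !P0 ?mulr0 ?mul0r ?subr0 ?eqxx //; lia.
  have [le_j' | lt_j'] := leqP j' j; first by lia.
  rewrite [mxentry Q 1 (B + j - j')]Q0; last by lia.
  by rewrite [mxentry P (A - i + j') 1]P0 ?mulr0 ?mul0r ?subr0 ?eqxx //; lia.
apply: (free_Tmx_triangular (pos := fun i j => (A - j, B + i)%N)) => /= [i j | i j i' j'] ij.
  rewrite mxentry_Tmx_outer ?subnK ?addnK; try lia.
  by rewrite (Q0 (B + i - j)%N) ?mulr0 ?mul0r ?sub0r ?oppr_eq0 ?mulf_neq0 ?signr_eq0 //; lia.
move=> ij'; rewrite mxentry_Tmx_outer; try lia.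
have [le_j' | lt_j'] := leqP j' j; last first.
  rewrite [mxentry P (A - j + j') 1]P0; last by lia.
  by rewrite [mxentry Q 1 (B + i - j')]Q0 ?mulr0 ?mul0r ?subr0 ?eqxx //; lia.
have [le_i' | lt_i'] := leqP i' i; first by lia.
by rewrite !Q0 ?mulr0 ?subr0 ?eqxx //; lia.
Qed.

(** The entry of [P_i Q_j] at [(r, k)] when [b = 2], one summand for each inner index. *)
Definition rank2_entry a c (P : 'M[F]_(a, 2)) (Q : 'M[F]_(2, c)) r k i j : F :=
  (-1) ^+ j *
    (mxentry P (r + i) 1 * (mxentry Q 1 (k - j) - j%:R * mxentry Q 2 (k.+1 - j))
     + (mxentry P (r + i) 2 - i%:R * mxentry P (r + i).-1 1) * mxentry Q 2 (k - j)).

Lemma mxentry_Tmx_rank2 a c (P : 'M[F]_(a, 2)) (Q : 'M[F]_(2, c)) i j r k :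
  (0 < r)%N -> (k <= c)%N ->
  mxentry (Tmx P Q i j) r k = rank2_entry P Q r k i j - rank2_entry P Q r k j i.
Proof.
move=> r_gt0 le_kc; rewrite mxentryB !mxentryM !big_ord_recl !big_ord0 /=.
rewrite !mxentry_Phi_iter_col1 // !mxentry_Phi_iter_col2 //.
by rewrite !mxentry_Phi_iter_last // !mxentry_Phi_iter_row1 // /rank2_entry; ring.
Qed.

Lemma free_Tmx_rank2 m (P : 'M[F]_(m, 2)) (Q : 'M[F]_(2, m)) :
  [pchar F] =i pred0 -> mxentry P m 1 != 0 -> mxentry Q 2 1 != 0 ->
  free [seq Tmx P Q i j | j <- iota 0 m.+1, i <- iota 0 j].
Proof.
move=> charF0 Pm Q1.
apply: (free_Tmx_triangular (pos := fun i j => (m - i, j)%N)) => /= [i j | i j i' j'] ij.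
  rewrite mxentry_Tmx_rank2 /rank2_entry; try lia.
  rewrite subnK ?subnn ?subSnn; last by lia.
  rewrite ![mxentry _ _ 0]mxentry_out; try lia.
  rewrite [mxentry P (m - i + j) 1]mxentry_out; last by lia.
  rewrite [mxentry P (m - i + j) 2]mxentry_out; last by lia.
  have nat_neq0 l : (0 < l)%N -> l%:R != 0 :> F.
    by move=> l_gt0; rewrite ((pcharf0P F).1 charF0); lia.
  (* [P_j Q_i] reaches this position only for [j = i + 1], and then its contribution to [T_{i,j}]
     doubles that of [P_i Q_j]. *)
  have [eq_j | neq_j] := eqVneq j i.+1.
    have -> : ((m - i + j).-1 = m)%N by lia.
    rewrite eq_j subSnn [X in X != 0](_ : _ = (-1) ^+ i * 2%:R * i.+1%:R
      * mxentry P m 1 * mxentry Q 2 1); last by rewrite exprS; ring.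
    by rewrite !mulf_neq0 ?signr_eq0 ?nat_neq0.
  rewrite [mxentry P _.-1 1 in X in _ - X]mxentry_out; last by lia.
  rewrite !(mulr0, mul0r, addr0, subr0, sub0r, mulrN, oppr0, add0r) oppr_eq0.
  by rewrite !mulf_neq0 ?signr_eq0 ?oppr_eq0 ?mulf_neq0 ?nat_neq0 //; lia.
move=> ij'; rewrite mxentry_Tmx_rank2; try lia.
set PQ := rank2_entry P Q (m - i) j.
(* So [P_x Q_y] can reach [(m - i, j)] only for [x <= i], [y <= j], or for [x = i + 1], [y < j]; the
   latter lowers the rank because [j] has weight 2. *)
have PQ0 x y : (i.+1 < x \/ j < y \/ i < x /\ j <= y)%N -> PQ x y = 0.
  rewrite /PQ /rank2_entry => out; have [le_jy | lt_yj] := leqP j y.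
    rewrite (_ : (j - y = 0)%N) ?[mxentry _ _ 0]mxentry_out ?mulr0; try lia.
    have [le_xi | lt_ix] := leqP x i.
      rewrite (_ : (j.+1 - y = 0)%N) ?[mxentry _ _ 0]mxentry_out; try lia.
      by rewrite !(mulr0, subr0, addr0).
    by rewrite [mxentry P _ 1]mxentry_out ?mul0r ?addr0 ?mulr0 //; lia.
  by rewrite ![mxentry P _ _]mxentry_out ?mul0r ?mulr0 ?subr0 ?mul0r ?addr0 ?mulr0 //; lia.
have [? | ?] := boolP ((i' <= i) && (j' <= j) || (i' <= i.+1) && (j' < j))%N; first by lia.
by rewrite !PQ0 ?subr0 ?eqxx //; lia.
Qed.

End ClosedForms.

(** * Necessity from the degree bound, and the classification *)

Lemma free_Tmx_degree_bound (F : fieldType) a b c (P : 'M[F]_(a, b))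
    (Q : 'M[F]_(b, c)) n d e : (1 < n)%N ->
  free [seq Tmx P Q i j | j <- iota 0 n, i <- iota 0 j] ->
  supported_above d P -> supported_above e Q -> (n * 2 + d + e < a + b + c + 3)%N.
Proof.
move=> n_gt1 freeT suppP suppQ.
have : Tmx P Q (n - 2) (n - 1) != 0.
  apply: free_not0 freeT _; apply/allpairsPdep; exists (n - 1)%N, (n - 2)%N.
  by rewrite !mem_iota; split => //; lia.
by move/(Tmx_neq0_bound suppP suppQ); lia.
Qed.

Theorem theorem5p1 (F : closedFieldType) (charF0 : [pchar F] =i pred0)
    (a b c : nat) (a_gt0 : (0 < a)%N) (b_gt0 : (0 < b)%N) (c_gt0 : (0 < c)%N)
    (P : 'M[F]_(a, b)) (Q : 'M[F]_(b, c))
    (n : nat) (def_n : n = maxn (a + b - 1) (b + c - 1)) :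
  (forall i : nat, (n <= i)%N -> Phi_iter i P = 0 /\ Phi_iter i Q = 0) /\
  ((1 < n)%N ->
    (free [seq Tmx P Q i j | j <- iota 0 n, i <- iota 0 j] <->
     exactly_one3
       [/\ mxentry P a 1 != 0, mxentry Q b 1 != 0
         & (a, b, c) \in [:: (n, 1, n); (n - 1, 2, n - 1);
                             (n, 1, n - 1); (n - 1, 1, n)]%N]
       [/\ mxentry P a 1 = 0, mxentry P (a - 1) 1 != 0, mxentry Q b 1 != 0
         & (a, b, c) = (n, 1, n)%N]
       [/\ mxentry P a 1 != 0, mxentry Q b 1 = 0, mxentry Q b 2 != 0
         & (a, b, c) = (n, 1, n)%N])).
Proof.
split=> [i le_ni | n_gt1]; first by split; apply: Phi_iter_nilpotent; lia.
split=> [freeT | ].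
  have bound d e := free_Tmx_degree_bound (d := d) (e := e) n_gt1 freeT.
  have suppP1 := @supported_above1 _ _ _ P; have suppQ1 := @supported_above1 _ _ _ Q.
  (* Since [2n >= a + 2b + c - 2], the bound gives [b <= 4 - (d + e)]. Hence [d + e = 4] is
     impossible, and [d + e = 3] forces [b = 1] and [a = c = n]. *)
  have le11 := bound _ _ suppP1 suppQ1.
  have [P0 | P_neq0] := eqVneq (mxentry P a 1) 0.
    have le21 := bound _ _ (supported_above2 P0) suppQ1.
    have [Q0 | Q_neq0] := eqVneq (mxentry Q b 1) 0.
      by have := bound _ _ (supported_above2 P0) (supported_above2 Q0); lia.
    have [eq_a eq_b eq_c] : [/\ a = n, b = 1 & c = n]%N by split; lia.
    apply: Or32; split; [by case | split=> // | by case].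
      clear - eq_a eq_b eq_c bound P0 suppQ1; subst b; apply/eqP=> P1.
      by have := bound _ _ (supported_above3_col P0 P1) suppQ1; lia.
    by rewrite eq_a eq_b eq_c.
  have [Q0 | Q_neq0] := eqVneq (mxentry Q b 1) 0.
    have le12 := bound _ _ suppP1 (supported_above2 Q0).
    have [eq_a eq_b eq_c] : [/\ a = n, b = 1 & c = n]%N by split; lia.
    apply: Or33; split; [by case | by case=> P0; rewrite P0 eqxx in P_neq0 | split=> //].
      clear - eq_a eq_b eq_c bound Q0 suppP1; subst b; apply/eqP=> Q1.
      by have := bound _ _ suppP1 (supported_above3_row Q0 Q1); lia.
    by rewrite eq_a eq_b eq_c.
  apply: Or31; split; first split=> //.
  - rewrite !inE !xpair_eqE; lia.
  - by case=> P0; rewrite P0 eqxx in P_neq0.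
  - by case=> _ Q0; rewrite Q0 eqxx in Q_neq0.
case=> [[[P_neq0 Q_neq0 +] _ _] | [_ [P0 P_neq0 Q_neq0 [eq_a eq_b eq_c]] _]
        | [_ _ [P_neq0 Q0 Q_neq0 [eq_a eq_b eq_c]]]].
- have [b2 | b_neq2] := eqVneq b 2%N => abc.
    have [eq_a eq_c] : a = n.-1 /\ c = n.-1 by rewrite !inE !xpair_eqE in abc; lia.
    rewrite -(prednK (ltnW n_gt1)); move: P Q P_neq0 Q_neq0.
    by rewrite b2 eq_a eq_c => P' Q'; apply: free_Tmx_rank2.
  have eq_b : b = 1%N by rewrite !inE !xpair_eqE in abc; lia.
  clear b_neq2; subst b.
  (* The triple [(n - 1, 1, n)] meets the first size alternative, [(n, 1, n - 1)] the second, and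
     [(n, 1, n)] both. *)
  apply: (free_Tmx_outer (A := a) (B := 1)) => //.
  - by move=> r ltr; apply: mxentry_out; lia.
  - by move=> k ltk; apply: mxentry_out; lia.
  - by rewrite !inE !xpair_eqE in abc; lia.
(* The last nonzero row of [P] is now [a - 1], so only the first size alternative holds. *)
- subst b; apply: (free_Tmx_outer (A := a - 1) (B := 1)) => //; last by lia.
    move=> r ltr; have [-> // | neq_ra] := eqVneq r a.
    by apply: mxentry_out; lia.
  by move=> k ltk; apply: mxentry_out; lia.
(* The first nonzero column of [Q] is now 2, so only the second size alternative holds. *)
- subst b; apply: (free_Tmx_outer (A := a) (B := 2)) => //; last by lia.
    by move=> r ltr; apply: mxentry_out; lia.
  move=> [|[|k]] // _; exact: mxentry_out.
Qed.
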